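(* Let $\mathcal{H}_1$ and $\mathcal{H}_2$ be two real Hilbert spaces, let $B_1:\mathcal{H}_1\to 2^{\mathcal{H}_1}$ and $F_1:\mathcal{H}_2\to 2^{\mathcal{H}_2}$ be two set-valued maximal monotone mappings, and let $A:\mathcal{H}_1\to\mathcal{H}_2$ be a bounded linear operator with adjoint $A^*$. Put $L=\|A^*A\|$ and $$\Gamma:=\{x\in\mathcal{H}_1 \mid 0\in B_1(x)\ \text{and}\ 0\in F_1(A(x))\}.$$ Let $\lambda>0$, suppose $\Gamma\neq\emptyset$ and $\gamma\in(0,2/L)$, and define $$S:=J_\lambda^{B_1}\left(I-\gamma A^*(I-J_\lambda^{F_1})A\right),\qquad S_{1/2}:=\tfrac12(I+S).$$ Then for every starting point $x^0\in\mathcal{H}_1$ the sequence $\{x^k\}_{k=0}^\infty$ generated by $$x^{k+1}=P_{H(x^0,x^k)\cap H(x^k,S_{1/2}(x^k))}(x^0),\qquad k\ge 0,$$ converges strongly (in norm) to a point $x^*\in\Gamma$.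
   Context: A set-valued mapping $B:\mathcal{H}\to 2^{\mathcal{H}}$ on a real Hilbert space $\mathcal{H}$ is monotone if $\langle u-v,x-y\rangle\ge 0$ for all $u\in B(x)$ and $v\in B(y)$; it is maximal monotone if it is monotone and its graph $G(B)=\{(x,u)\in\mathcal{H}\times\mathcal{H}\mid u\in B(x)\}$ is not properly contained in the graph of any other monotone mapping. For $\lambda>0$ the resolvent of $B$ is $J_\lambda^B:=(I+\lambda B)^{-1}$, where $I$ is the identity operator; it is well known that for maximal monotone $B$ it is single-valued and defined on all of $\mathcal{H}$. For $x,y\in\mathcal{H}_1$, $H(x,y):=\{u\in\mathcal{H}_1\mid\langle u-y,x-y\rangle\le 0\}$ (a closed half-space if $x\ne y$, and all of $\mathcal{H}_1$ if $x=y$). $P_C$ denotes the metric (nearest-point) projection onto a nonempty closed convex set $C$. *)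

(* Defs.v *)
From HB Require Import structures.
From mathcomp Require Import all_boot all_order all_algebra.
From mathcomp Require Import all_classical all_reals all_analysis.

Set Implicit Arguments.
Unset Strict Implicit.
Unset Printing Implicit Defensive.

Import Order.TTheory GRing.Theory Num.Theory.
Import numFieldNormedType.Exports.

Local Open Scope classical_set_scope.
Local Open Scope ring_scope.

HB.mixin Record NormedModule_isHilbert (R : realType) V
    & CompleteNormedModule R V := {
  inner : {dot V for (@idfun R)};
  innerxx : forall x : V, inner x x = `|x| ^+ 2
}.

#[short(type="hilbertType")]
HB.structure Definition Hilbert (R : realType) :=
  {V of CompleteNormedModule R V & NormedModule_isHilbert R V}.

Section monotone_mappings.
Context {R : realType} {H : hilbertType R}.
Implicit Types (B : H -> set H) (C : set H) (x y u v : H) (lambda : R).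

Definition mapping_graph B : set (H * H) := [set xu | B xu.1 xu.2].

Definition monotone_mapping B :=
  forall x y u v, B x u -> B y v -> 0 <= inner (u - v) (x - y).

Definition maximal_monotone B :=
  monotone_mapping B /\
  forall B', monotone_mapping B' -> ~ (mapping_graph B `<` mapping_graph B').

(* The set-valued mapping (I + lambda B)^-1. *)
Definition resolvent_set lambda B x : set H :=
  [set y | exists2 u, B y u & y + lambda *: u = x].

(* [xget 0 P] is an element of [P] if there is one, and 0 otherwise.  The
   default is never reached for a maximal monotone [B] and [0 < lambda], nor in
   the adjoint of a bounded operator, nor in the projection onto a nonempty
   closed convex set; in these cases the element is moreover unique. *)
Definition resolvent lambda B x : H := xget 0 (resolvent_set lambda B x).

Definition metric_proj C x : H :=
  xget 0 [set p | C p /\ forall q, C q -> `|x - p| <= `|x - q|].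

Definition cut_halfspace x y : set H := [set u | inner (u - y) (x - y) <= 0].

End monotone_mappings.

Definition opnorm {R : realType} {V W : normedModType R} (f : V -> W) : R :=
  sup [set `|f x| | x in [set x | `|x| <= 1]].

Section split_inclusion.
Context {R : realType} {H1 H2 : hilbertType R}.

Definition adjoint (A : H1 -> H2) (y : H2) : H1 :=
  xget 0 [set z | forall x, inner (A x) y = inner x z].

Definition solution_set (B1 : H1 -> set H1) (F1 : H2 -> set H2)
    (A : H1 -> H2) : set H1 := [set x | B1 x 0 /\ F1 (A x) 0].

Definition split_step (B1 : H1 -> set H1) (F1 : H2 -> set H2) (A : H1 -> H2)
    (lambda gamma : R) (x : H1) : H1 :=
  resolvent lambda B1
    (x - gamma *: adjoint A (A x - resolvent lambda F1 (A x))).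

Definition half_averaged (S : H1 -> H1) (x : H1) : H1 := 2^-1 *: (x + S x).

End split_inclusion.

(* Main.v *)
(** Existence facts (Riesz representation, projection onto a closed convex set,
    Minty's theorem) all come from minimizing c + (|a|^2 + |b|^2)/2 over a closed
    convex set of triples (a, b, c), where minimizing sequences are Cauchy by
    uniform convexity.

    S is nonexpansive with fixed-point set Γ, and the projections give
    |x_k - x_0| <= |q - x_0| for every q in Γ, together with x_k - S x_k -> 0.
    Strong convergence needs no weak compactness: the solutions z_s of
    z - S z = s (x_0 - z) converge in norm to some p in Γ as s -> 0, because
    |z_s - x_0| is monotone in s and controls the mutual distances.
    Monotonicity of I - S at x_k and z_s gives
    limsup_k <x_0 - z_s, x_k - z_s> <= 0 for each s, while
    |x_k - p|^2 <= 2 <x_0 - p, x_k - p> follows from |x_k - x_0| <= |p - x_0|;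
    letting s -> 0 yields x_k -> p. *)

Require Import Defs.
From HB Require Import structures.
From mathcomp Require Import all_boot all_order all_algebra.
From mathcomp Require Import all_classical all_reals all_analysis.
From mathcomp Require Import ring lra.

Import Order.TTheory GRing.Theory Num.Theory.
Import numFieldNormedType.Exports.

Local Open Scope classical_set_scope.
Local Open Scope ring_scope.

(** * Inner products and the Cauchy-Schwarz inequality *)

Section inner_theory.
Context {R : realType} {H : hilbertType R}.
Implicit Types (x y z : H) (a : R).

Lemma innerC x y : inner x y = inner y x.
Proof. by rewrite hermC /= expr0 mul1r. Qed.

Lemma innerDl x y z : inner (x + y) z = inner x z + inner y z.
Proof. by rewrite linearDl. Qed.

Lemma innerDr x y z : inner z (x + y) = inner z x + inner z y.
Proof. by rewrite linearDr. Qed.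

Lemma innerNl x z : inner (- x) z = - inner x z.
Proof. by rewrite linearNl. Qed.

Lemma innerNr x z : inner z (- x) = - inner z x.
Proof. by rewrite linearNr. Qed.

Lemma innerZl a x z : inner (a *: x) z = a * inner x z.
Proof. by rewrite linearZl_LR. Qed.

Lemma innerZr a x z : inner z (a *: x) = a * inner z x.
Proof. by rewrite linearZr_LR. Qed.

Lemma inner0l z : inner 0 z = 0.
Proof. by rewrite linear0l. Qed.

Lemma inner0r z : inner z 0 = 0.
Proof. by rewrite linear0r. Qed.

Definition innerE := (innerDl, innerDr, innerNl, innerNr, innerZl, innerZr,
  inner0l, inner0r).

Lemma innerxx_ge0 x : 0 <= inner x x.
Proof. by rewrite innerxx sqr_ge0. Qed.

Lemma innerxx_eq0 x : inner x x = 0 -> x = 0.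
Proof. by rewrite innerxx => /eqP; rewrite sqrf_eq0 normr_eq0 => /eqP. Qed.

Lemma inner_inj y z : (forall x, inner x y = inner x z) -> y = z.
Proof.
move=> yz; apply/eqP; rewrite -subr_eq0; apply/eqP/innerxx_eq0.
by rewrite innerDr innerNr yz subrr.
Qed.

Lemma inner_le_norm x y : inner x y <= `|x| * `|y|.
Proof.
have [->|y0] := eqVneq y 0; first by rewrite inner0r normr0 mulr0.
have [->|x0] := eqVneq x 0; first by rewrite inner0l normr0 mul0r.
have x_gt0 : 0 < `|x| by rewrite normr_gt0.
have y_gt0 : 0 < `|y| by rewrite normr_gt0.
have := innerxx_ge0 (`|y| *: x - `|x| *: y).
rewrite !innerE !innerxx (innerC y x).
have mn0 : 0 < 2 * (`|x| * `|y|) by rewrite !mulr_gt0.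
move=> h; rewrite -subr_ge0 -(pmulr_rge0 _ mn0); apply: le_trans h _.
by rewrite le_eqVlt; apply/orP; left; apply/eqP; ring.
Qed.

Lemma norm_inner_le x y : `|inner x y| <= `|x| * `|y|.
Proof.
rewrite ler_norml inner_le_norm andbT lerNl -innerNl.
by rewrite -(normrN x) inner_le_norm.
Qed.

Lemma continuous_innerr x : continuous (fun y => inner x y).
Proof.
apply/(@linear_bounded_continuous _ _ R^o)/linear_boundedP.
near=> r => y; apply: le_trans (norm_inner_le _ _) _.
by apply: ler_wpM2r => //; near: r; exact: nbhs_pinfty_ge.
Unshelve. all: by end_near. Qed.

Lemma continuous_innerl y : continuous (fun x => inner x y).
Proof.
have -> : (fun x => inner x y) = (fun x => inner y x).
  by apply/funext => x; rewrite innerC.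
exact: continuous_innerr.
Qed.

Lemma continuous_innerxx : continuous (fun x => inner x x).
Proof.
have -> : (fun x => inner x x) = (fun x => `|x| * `|x|).
  by apply/funext => x; rewrite innerxx expr2.
by move=> x; apply: cvgM; exact: norm_continuous.
Qed.

End inner_theory.

(** Cauchy criterion in the form supplied by the parallelogram law and by monotone sequences of
    norms. *)
Lemma sqr_dist_cauchy_cvg (R : realType) (V : completeNormedModType R)
    (u : nat -> V) (e : nat -> R) :
  e @ \oo --> (0 : R) ->
  (forall n k, `|u n - u k| ^+ 2 <= e n + e k) -> cvg (u @ \oo).
Proof.
move=> e0 ue; apply/cauchy_cvgP/cauchy_ballP => r r0; near_simpl.
have r2 : 0 < r ^+ 2 / 2 by rewrite divr_gt0// exprn_gt0.
have : \forall n \near \oo, `|e n| < r ^+ 2 / 2.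
  by move/cvgr0Pnorm_lt: e0; apply.
move=> [N _ eN]; exists ([set n | N <= n], [set n | N <= n])%N.
  by split; exists N.
move=> [n k] [/= Nn Nk]; rewrite -ball_normE /=.
rewrite -(@ltr_pXn2r _ 2)// ?nnegrE// ?(ltW r0)//.
apply: le_lt_trans (ue _ _) _.
have := eN _ Nn; have := eN _ Nk; rewrite /= => h1 h2.
have := ler_norm (e n); have := ler_norm (e k); lra.
Unshelve. all: by end_near. Qed.

(** * Minimization of the energy *)

Section energy.
Context {R : realType} {V W : hilbertType R}.
Implicit Types (p q : V * W * R) (E : set (V * W * R)).

(** The scalar slot holds the remaining cost: minus a functional, zero, or an epigraph variable. *)
Definition energy p : R :=
  p.2 + 2^-1 * (inner p.1.1 p.1.1 + inner p.1.2 p.1.2).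

Definition segment p q (t : R) : V * W * R :=
  (p.1.1 + t *: (q.1.1 - p.1.1), p.1.2 + t *: (q.1.2 - p.1.2),
   p.2 + t * (q.2 - p.2)).

(** The quadratic defect is exact; at [t = 1/2] this is the parallelogram law. *)
Lemma energy_segment p q t : energy (segment p q t) =
  energy p + t * (energy q - energy p) - 2^-1 * (t * (1 - t)) *
    (inner (q.1.1 - p.1.1) (q.1.1 - p.1.1) +
     inner (q.1.2 - p.1.2) (q.1.2 - p.1.2)).
Proof.
case: p q => [[a b] c] [[a' b'] c']; rewrite /energy /segment /=.
by rewrite !innerE (innerC a' a) (innerC b' b); field.
Qed.

Lemma energy_min_exists E :
  closed E -> E !=set0 ->
  (forall p q t, E p -> E q -> 0 <= t <= 1 -> E (segment p q t)) ->
  (exists m, forall p, E p -> m <= energy p) ->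
  exists2 p, E p & forall q, E q -> energy p <= energy q.
Proof.
move=> clE E0 cvxE [m0 m0E].
pose D := energy @` E; pose m := inf D.
have infD : has_inf D.
  split; first by case: E0 => p Ep; exists (energy p), p.
  by exists m0 => _ [p Ep <-]; exact: m0E.
have mE q : E q -> m <= energy q.
  by move=> Eq; apply: ge_inf; [exact: infD.2|exists q].
have /choice[s sP] n : exists p, E p /\ energy p < m + n.+1%:R^-1.
  have [|_ [p Ep <-] lep] := @inf_adherent _ D n.+1%:R^-1 _ infD.
    by rewrite invr_gt0.
  by exists p.
have harm0 : (fun n => n.+1%:R^-1 : R) @ \oo --> (0 : R) by exact: cvg_harmonic.
(* The midpoint has energy at least [m], so one eighth of the squared distance is at most half the
   sum of the two excesses over [m]. *)
have dist n k : inner ((s n).1.1 - (s k).1.1) ((s n).1.1 - (s k).1.1) +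
    inner ((s n).1.2 - (s k).1.2) ((s n).1.2 - (s k).1.2) <=
    4 * n.+1%:R^-1 + 4 * k.+1%:R^-1.
  have := mE _ (cvxE (s k) (s n) 2^-1 (sP k).1 (sP n).1 _).
  rewrite energy_segment invr_ge0 ler0n invf_le1// ler1n => /(_ isT).
  have := (sP k).2; have := (sP n).2.
  move: (n.+1%:R^-1) (k.+1%:R^-1) (energy _) (energy _) (inner _ _ + _).
  move=> i j f g d; lra.
have e0 : (fun n => 4 * n.+1%:R^-1 : R) @ \oo --> (0 : R).
  by rewrite -(mulr0 4); apply: cvgMr.
have /cvg_ex[a sa] : cvg ((fun n => (s n).1.1) @ \oo).
  apply: sqr_dist_cauchy_cvg e0 _ => n k; rewrite -innerxx.
  by apply: le_trans (dist n k); rewrite lerDl innerxx_ge0.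
have /cvg_ex[b sb] : cvg ((fun n => (s n).1.2) @ \oo).
  apply: sqr_dist_cauchy_cvg e0 _ => n k; rewrite -innerxx.
  by apply: le_trans (dist n k); rewrite lerDr innerxx_ge0.
have sm : (fun n => energy (s n)) @ \oo --> m.
  apply: (@squeeze_cvgr _ _ _ _ (fun=> m) (fun n => m + n.+1%:R^-1)).
  - by apply: nearW => n; rewrite mE ?(ltW (sP n).2)//; exact: (sP n).1.
  - exact: cvg_cst.
  - by rewrite -[X in _ --> X]addr0; apply: cvgD => //; exact: cvg_cst.
(* The scalar parts converge because they are the energies minus the continuous quadratic terms. *)
pose c := m - 2^-1 * (inner a a + inner b b).
have sc : (fun n => (s n).2) @ \oo --> c.
  have -> : (fun n => (s n).2) = (fun n => energy (s n) -
      2^-1 * (inner (s n).1.1 (s n).1.1 + inner (s n).1.2 (s n).1.2)).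
    by apply/funext => n; rewrite /energy addrK.
  apply: cvgB => //; apply: cvgMr; apply: cvgD.
    exact: (continuous_cvg _ (@continuous_innerxx _ _ a)).
  exact: (continuous_cvg _ (@continuous_innerxx _ _ b)).
exists (a, b, c) => [|q /mE]; last by rewrite {2}/energy /= /c subrK.
have sabc : (fun n => ((s n).1.1, (s n).1.2, (s n).2)) @ \oo --> (a, b, c).
  exact: cvg_pair (cvg_pair sa sb) sc.
have Es : \forall n \near \oo, E ((s n).1.1, (s n).1.2, (s n).2).
  by apply: nearW => n; rewrite -!surjective_pairing; exact: (sP n).1.
exact: (@closed_cvg _ _ _ _ _ E clE Es _ sabc).
Qed.

(** First-order optimality: the expression is the derivative of the energy at [p] in the direction
    [q - p]. *)
Lemma energy_min_variational E :
  closed E -> E !=set0 ->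
  (forall p q t, E p -> E q -> 0 <= t <= 1 -> E (segment p q t)) ->
  (exists m, forall p, E p -> m <= energy p) ->
  exists2 p, E p & forall q, E q -> 0 <= (q.2 - p.2) +
    inner p.1.1 (q.1.1 - p.1.1) + inner p.1.2 (q.1.2 - p.1.2).
Proof.
move=> clE E0 cvxE bE; have [p Ep minp] := energy_min_exists E clE E0 cvxE bE.
exists p => // q Eq; set v := (X in 0 <= X).
pose d := inner (q.1.1 - p.1.1) (q.1.1 - p.1.1) +
  inner (q.1.2 - p.1.2) (q.1.2 - p.1.2).
have d0 : 0 <= d by rewrite addr_ge0 ?innerxx_ge0.
have vE : energy q - energy p = v + 2^-1 * d.
  rewrite /v /d /energy; case: p q {minp Ep Eq v d d0} => [[a b] c] [[a' b'] c'].
  by rewrite /= !innerE (innerC a' a) (innerC b' b); field.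
have tv t : 0 < t -> t <= 1 -> 0 <= v + 2^-1 * t * d.
  move=> t0 t1.
  have := minp _ (cvxE p q t Ep Eq _); rewrite (ltW t0) t1 => /(_ isT).
  rewrite energy_segment vE -/d => h.
  rewrite -(pmulr_rge0 _ t0); lra.
rewrite leNgt; apply/negP => v0.
(* With [v < 0], the bound [tv] fails at [t = 1] if [d < - v], and otherwise at [t = - v / d], where
   it reads [v / 2 >= 0]. *)
have [d1|d1] := leP (- v) d; last first.
  have := tv 1 ltr01 (lexx _); lra.
have d_gt0 : 0 < d by lra.
have := tv (- v / d); rewrite divr_gt0 ?oppr_gt0// ler_pdivrMr// mul1r.
by move=> /(_ isT d1); rewrite -mulrA divfK ?gt_eqF//; lra.
Qed.

End energy.

(** * Riesz representation, projections and adjoints *)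

Section riesz_projection.
Context {R : realType} {H : hilbertType R}.

Lemma continuous_fst_fst (V W U : topologicalType) :
  continuous (fun p : V * W * U => p.1.1).
Proof. by move=> p; apply: (cvg_comp fst fst); exact: cvg_fst. Qed.

Lemma continuous_snd_fst (V W U : topologicalType) :
  continuous (fun p : V * W * U => p.1.2).
Proof.
by move=> p; apply: (cvg_comp fst snd); [exact: cvg_fst|exact: cvg_snd].
Qed.

Lemma riesz_representation (f : {linear H -> R^o}) :
  continuous f -> exists z, forall x, f x = inner x z.
Proof.
move=> cf; pose E : set (H * H * R) := [set p | p.2 = - f p.1.1].
have [||p q t||p Ep minp] := @energy_min_variational _ _ _ E.
- suff -> : E = (fun p => p.2 + f p.1.1) @^-1` [set 0].
    apply: preimage_closed (@closed_eq R 0) => p _.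
    apply: cvgD; first exact: cvg_snd.
    apply: (@continuous_comp _ _ _ (fun p : H * H * R => p.1.1) f).
      exact: continuous_fst_fst.
    exact: cf.
  rewrite /E; apply/seteqP; split => p /=; first by move=> ->; rewrite addNr.
  by move/eqP; rewrite addr_eq0 => /eqP.
- by exists (0, 0, 0); rewrite /E /= linear0 oppr0.
- rewrite /E /= => -> -> _; rewrite linearD linearZ linearB /=.
  by rewrite -[t *: _]/(t * (f q.1.1 - f p.1.1)); ring.
- have /linear_boundedP[M [_ fM]] : bounded_near f (nbhs (0 : H)).
    exact/linear_bounded_continuous.
  have {}fM x : `|f x| <= (M + 1) * `|x| by apply: fM; rewrite ltrDl.
  exists (- (2^-1 * (M + 1) ^+ 2)) => p /= pE; rewrite /energy pE.
  have := innerxx_ge0 p.1.2; rewrite !innerxx => h.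
  have := sqr_ge0 (`|p.1.1| - (M + 1)).
  have := le_trans (ler_norm _) (fM p.1.1); nra.
exists p.1.1 => x.
(* Testing optimality in the directions [x] and [- x] turns the inequality into an equality. *)
have /= := minp (p.1.1 + x, p.1.2, - f (p.1.1 + x)) erefl.
have /= := minp (p.1.1 - x, p.1.2, - f (p.1.1 - x)) erefl.
rewrite Ep linearD linearB subrr inner0r /= !innerE (innerC x); lra.
Qed.

Lemma metric_projP (C : set H) (x : H) :
  closed C -> C !=set0 ->
  (forall a b (t : R), C a -> C b -> 0 <= t <= 1 -> C (a + t *: (b - a))) ->
  C (metric_proj C x) /\
  forall q, C q -> inner (x - metric_proj C x) (q - metric_proj C x) <= 0.
Proof.
move=> clC [c0 Cc0] cvxC.
pose E : set (H * H * R) := [set p | C (x + p.1.1) /\ p.2 = 0].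
have [||p q t||p [Cp p0] minp] :=
  @energy_min_variational _ _ _ E.
- apply: closedI; last first.
    by apply: preimage_closed (@closed_eq R 0) => p _; exact: cvg_snd.
  apply: (@preimage_closed _ _ (fun p : H * H * R => x + p.1.1)) clC => p _.
  by apply: cvgD; [exact: cvg_cst|exact: continuous_fst_fst].
- by exists (c0 - x, 0, 0); rewrite /E /= addrC subrK.
- rewrite /E /= => -[Cp ->] [Cq ->] t01.
  rewrite subrr mulr0 addr0; split => //.
  have := cvxC _ _ t Cp Cq t01.
  by rewrite opprD addrACA subrr add0r -addrA.
- exists 0 => p [_ p0]; rewrite /energy p0 add0r mulr_ge0 ?invr_ge0//.
  by rewrite addr_ge0 ?innerxx_ge0.
have {}minp q : C q -> 0 <= inner p.1.1 (q - (x + p.1.1)).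
  move=> Cq; have /= := minp (q - x, p.1.2, 0).
  rewrite p0 !subrr inner0r add0r addr0 opprD addrA; apply.
  by split => //=; rewrite addrC subrK.
have xp : x - (x + p.1.1) = - p.1.1 by rewrite opprD addrA subrr add0r.
(* Pythagorean form of the variational inequality: it makes [x + p.1.1] a nearest point and
   identifies it with the one chosen by [xget]. *)
have near q : C q -> `|p.1.1| ^+ 2 + `|q - (x + p.1.1)| ^+ 2 <= `|x - q| ^+ 2.
  move=> Cq; have := minp q Cq; rewrite -!innerxx !innerE.
  rewrite !(innerC q) (innerC p.1.1 x); lra.
have : [set p | C p /\ forall q, C q -> `|x - p| <= `|x - q|]
    (metric_proj C x).
  apply: xgetPex; exists (x + p.1.1); split => // q Cq.
  rewrite xp normrN -(@ler_pXn2r _ 2)// ?nnegrE//.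
  by apply: le_trans (near q Cq); rewrite lerDl sqr_ge0.
set P := metric_proj C x => -[CP /(_ _ Cp)].
rewrite xp normrN -(@ler_pXn2r _ 2)// ?nnegrE// => le1.
have -> : P = x + p.1.1.
  apply/eqP; rewrite -subr_eq0 -normr_eq0 -sqrf_eq0 eq_le sqr_ge0 andbT.
  by have := near _ CP; lra.
split => // q Cq; rewrite xp innerNl oppr_le0.
exact: minp.
Qed.

End riesz_projection.

Section adjoint_theory.
Context {R : realType} {H1 H2 : hilbertType R} (A : {linear H1 -> H2}).
Hypothesis bA : bounded_near A (nbhs (0 : H1)).

(** Riesz representation of [x |-> <A x, y>] shows that the set defining [adjoint] is inhabited. *)
Lemma adjointP x y : inner (A x) y = inner x (adjoint A y).
Proof.
have cA : continuous A by exact/linear_bounded_continuous.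
pose f x := inner (A x) y : R^o.
have lf : linear f by move=> a u v; rewrite /f linearP innerDl innerZl.
pose F : {linear H1 -> R^o} := HB.pack f (GRing.isLinear.Build _ _ _ _ f lf).
have [|z zP] := @riesz_representation _ _ F.
  move=> u; apply: (@continuous_comp _ _ _ A (fun v => inner v y)).
    exact: cA.
  exact: continuous_innerl.
have : [set z | forall x, inner (A x) y = inner x z] (adjoint A y).
  by apply: xgetPex; exists z.
exact.
Qed.

Lemma adjointZ (c : R) y : adjoint A (c *: y) = c *: adjoint A y.
Proof. by apply: inner_inj => x; rewrite -adjointP !innerZr -adjointP. Qed.

Lemma adjointB y z : adjoint A (y - z) = adjoint A y - adjoint A z.
Proof. by apply: inner_inj => x; rewrite -adjointP !innerE -!adjointP. Qed.

(** The supremum [opnorm] bounds its set only once that set is known to be bounded. The bound on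
    [A*] comes from [|A* y|^2 = <A A* y, y>]. *)
Lemma has_ubound_adjointA :
  has_ubound [set `|(adjoint A \o A) z| | z in [set z | `|z| <= 1]].
Proof.
have /linear_boundedP[M [_ AM]] := bA.
have {}AM z : `|A z| <= (`|M| + 1) * `|z|.
  by apply: AM; have := ler_norm M; lra.
have adjM y : `|adjoint A y| <= (`|M| + 1) * `|y|.
  have [->|w0] := eqVneq (adjoint A y) 0.
    by rewrite normr0 mulr_ge0// addr_ge0.
  have w_gt0 : 0 < `|adjoint A y| by rewrite normr_gt0.
  rewrite -(ler_pM2l w_gt0) -expr2 -innerxx -adjointP.
  apply: le_trans (inner_le_norm _ _) _.
  by rewrite mulrA [_ * (_ + 1)]mulrC; exact: ler_wpM2r.
exists ((`|M| + 1) * (`|M| + 1)) => _ [z /= z1 <-].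
apply: le_trans (adjM _) _; apply: ler_wpM2l; first by rewrite addr_ge0.
by apply: le_trans (AM z) _; rewrite ler_piMr ?addr_ge0.
Qed.

Lemma opnorm_adjointA_ge0 : 0 <= opnorm (adjoint A \o A).
Proof.
apply: le_trans (normr_ge0 ((adjoint A \o A) 0)) _.
by apply: (ub_le_sup has_ubound_adjointA); exists 0 => //=; rewrite normr0.
Qed.

Lemma norm_adjointA_le x :
  `|adjoint A (A x)| <= opnorm (adjoint A \o A) * `|x|.
Proof.
have [->|x0] := eqVneq x 0.
  by rewrite linear0 -(scale0r 0) adjointZ scale0r !normr0 mulr0.
have x_gt0 : 0 < `|x| by rewrite normr_gt0.
rewrite -ler_pdivrMr// mulrC -[X in X * _]ger0_norm ?invr_ge0//.
rewrite -normrZ -adjointZ -linearZ; apply: (ub_le_sup has_ubound_adjointA).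
exists (`|x|^-1 *: x) => //=.
by rewrite normrZ ger0_norm ?invr_ge0// mulVf ?gt_eqF.
Qed.

(* |A* d|^2 = <d, A A* d> and |A w|^2 = <w, A* A w>. *)
Lemma norm_adjoint_sqr_le y :
  `|adjoint A y| ^+ 2 <= opnorm (adjoint A \o A) * `|y| ^+ 2.
Proof.
set w := adjoint A y; set L := opnorm _.
have [->|w0] := eqVneq w 0.
  by rewrite normr0 expr0n mulr_ge0 ?sqr_ge0 ?opnorm_adjointA_ge0.
have w_gt0 : 0 < `|w| by rewrite normr_gt0.
have Aw : `|A w| ^+ 2 <= L * `|w| ^+ 2.
  rewrite -innerxx adjointP; apply: le_trans (inner_le_norm _ _) _.
  by rewrite expr2 mulrCA; apply: ler_wpM2l => //; exact: norm_adjointA_le.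
have ww : `|w| ^+ 2 <= `|A w| * `|y|.
  by rewrite -innerxx {2}/w -adjointP inner_le_norm.
have w2 : 0 < `|w| ^+ 2 by rewrite exprn_gt0.
rewrite -(ler_pM2l w2); apply: le_trans (_ : (`|A w| * `|y|) ^+ 2 <= _).
  by rewrite [leRHS]expr2; apply: ler_pM => //; exact: ltW.
by rewrite exprMn [leRHS]mulrCA [leRHS]mulrA; apply: ler_wpM2r.
Qed.

End adjoint_theory.

(** * Minty's theorem *)

Section minty.
Context {R : realType} {H : hilbertType R}.
Implicit Types (B : H -> set H).

(** Otherwise adjoining [(x, u)] to the graph would give a proper monotone extension. *)
Lemma maximal_monotone_mem B x u : maximal_monotone B ->
  (forall y v, B y v -> 0 <= inner (u - v) (x - y)) -> B x u.
Proof.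
move=> [mB maxB] xu; apply: contrapT => nBxu.
pose B' y := B y `|` [set v | y = x /\ v = u].
apply: (maxB B') => [y z v w|].
  move=> [Bv|[-> ->]] [Bw|[-> ->]].
  - exact: mB.
  - by rewrite -opprB -[X in inner _ X]opprB innerNl innerNr opprK xu.
  - exact: xu.
  - by rewrite subrr inner0l.
split => [[y v] Byv|/(_ (x, u))]; first by left.
by apply: contra_not nBxu => /(_ _)/=; apply; right.
Qed.

(* The energy is minimized over the epigraph of the Fitzpatrick function
   (x, u) |-> sup {<x, v> + <y, u> - <y, v> | v \in B y}, which maximality
   bounds below by <x, u>; the minimizer has the form (x, - x). *)
Lemma minty_zero B : monotone_mapping B ->
  (forall x u, (forall y v, B y v -> 0 <= inner (u - v) (x - y)) -> B x u) ->
  exists x, B x (- x).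
Proof.
move=> mB maxB.
have [y0 [v0 Bv0]] : exists y v, B y v.
  apply: contrapT => nB; apply: (nB); exists 0, 0; apply: maxB => y v Byv.
  by case: nB; exists y, v.
pose E : set (H * H * R) := [set p | forall y v, B y v ->
  inner p.1.1 v + inner y p.1.2 - inner y v <= p.2].
have EB y v : B y v -> E (y, v, inner y v).
  move=> Byv z w Bzw /=; have := mB _ _ _ _ Byv Bzw.
  rewrite !innerE (innerC v y) (innerC v z) (innerC w y) (innerC w z); lra.
(* Were the scalar below [<a, b>], the pair [(a, b)] would be monotonically related to the graph,
   hence in it, and the epigraph constraint at that pair would be violated. *)
have Ege p : E p -> inner p.1.1 p.1.2 <= p.2.
  move=> Ep; rewrite leNgt; apply/negP => lt_p.
  have Bp : B p.1.1 p.1.2.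
    apply: maxB => y v Byv; have := Ep _ _ Byv; rewrite !innerE.
    rewrite (innerC p.1.2 p.1.1) (innerC v) (innerC p.1.2) (innerC v); lra.
  by have := Ep _ _ Bp; lra.
have [||p q t Ep Eq /andP[t0 t1] y v Byv||[[a b] c] Ep minp] :=
  @energy_min_variational _ _ _ E.
- have -> : E = \bigcap_(yv in [set yv | B yv.1 yv.2])
      (fun p => p.2 - (inner p.1.1 yv.2 + inner yv.1 p.1.2 - inner yv.1 yv.2))
      @^-1` [set r | 0 <= r].
    apply/seteqP; split => [p Ep [y v] /= Byv|p Ep y v Byv].
      by rewrite subr_ge0; exact: Ep.
    by have := Ep (y, v) Byv; rewrite /= subr_ge0.
  apply: closed_bigI => -[y v] _ /=.
  apply: preimage_closed (@closed_ge R 0) => p _.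
  apply: cvgB; first exact: cvg_snd.
  apply: cvgB; last exact: cvg_cst.
  apply: cvgD.
    apply: (@continuous_comp _ _ _ (fun p : H * H * R => p.1.1)
      (fun a => inner a v)); first exact: continuous_fst_fst.
    exact: continuous_innerl.
  apply: (@continuous_comp _ _ _ (fun p : H * H * R => p.1.2) (inner y)).
    exact: continuous_snd_fst.
  exact: continuous_innerr.
- by exists (y0, v0, inner y0 v0); exact: EB.
- have := Ep _ _ Byv; have := Eq _ _ Byv.
  by rewrite /segment /= !innerE; nra.
- exists 0 => p /Ege; rewrite /energy => Ep.
  have := innerxx_ge0 (p.1.1 + p.1.2).
  by rewrite !innerE (innerC p.1.2 p.1.1); lra.
(* Optimality against [(y, v, <y, v>)], combined with [<a, b> <= c]. Maximality then puts
   [(- b, - a)] in the graph, and testing at this very pair forces [a + b = 0]. *)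
have Bba : forall y v, B y v -> inner (a + b) (a + b) <=
    inner (- a - v) (- b - y).
  move=> y v Byv; have /= := minp _ (EB _ _ Byv); have /= := Ege _ Ep.
  rewrite !innerE (innerC b a) (innerC v b) (innerC v y); lra.
have Bab : B (- b) (- a).
  by apply: maxB => y v /Bba; apply: le_trans; exact: innerxx_ge0.
have := Bba _ _ Bab; rewrite !subrr inner0l => ab_le0.
have /eqP : a + b = 0.
  by apply/innerxx_eq0/le_anti; rewrite ab_le0 innerxx_ge0.
by rewrite addr_eq0 => /eqP ab; exists a; rewrite {1}ab.
Qed.

Lemma resolventP B (lambda : R) x : maximal_monotone B -> 0 < lambda ->
  B (resolvent lambda B x) (lambda^-1 *: (x - resolvent lambda B x)).
Proof.
move=> maxB l0; have ln0 : lambda != 0 by rewrite gt_eqF.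
(* Minty's theorem for the shifted and scaled [B'] gives [y] with [- y] in [B' y], that is,
   [(x - y) / lambda] in [B y]. *)
pose B' y : set H := [set w | B y (lambda^-1 *: (w + x))].
have [|z u zu|y] := @minty_zero B'.
- move=> y z v w Bv Bw; have := maxB.1 _ _ _ _ Bv Bw.
  by rewrite -scalerBr innerZl pmulr_rge0 ?invr_gt0// opprD addrACA subrr addr0.
- apply: (maximal_monotone_mem _ _ _ maxB) => y v Byv.
  have := zu y (lambda *: v - x); rewrite /B' /= subrK scalerA mulVf// scale1r.
  move=> /(_ Byv); rewrite opprD opprK addrA addrAC.
  rewrite -[X in inner (X - _)]scale1r -(mulfV ln0) -scalerA -scalerBr innerZl.
  by rewrite pmulr_rge0.
rewrite /B' /= addrC => By.
have [u Bu xE] : resolvent_set lambda B x (resolvent lambda B x).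
  apply: xgetPex; exists y, (lambda^-1 *: (x - y)) => //.
  by rewrite scalerA mulfV// scale1r addrC subrK.
by rewrite -[X in X - _]xE [_ + _ *: u]addrC addrK scalerA mulVf// scale1r.
Qed.

End minty.

(** * Resolvents and the split step *)

Lemma subrACA (V : zmodType) (a b c d : V) : a - b - (c - d) = a - c - (b - d).
Proof. by rewrite !opprB addrACA [RHS]addrACA [- b - c]addrC. Qed.

Section resolvent_theory.
Context {R : realType} {H : hilbertType R}.
Context {B : H -> set H} {lambda : R}.
Hypotheses (maxB : maximal_monotone B) (l0 : 0 < lambda).
Local Notation J := (resolvent lambda B).

Lemma resolvent_firmly_nonexpansive x y :
  inner (J x - J y) (J x - J y) <= inner (x - y) (J x - J y).
Proof.
have := maxB.1 _ _ _ _ (resolventP B lambda x maxB l0)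
  (resolventP B lambda y maxB l0).
rewrite -scalerBr innerZl pmulr_rge0 ?invr_gt0//.
by move: (J x) (J y) => u v; rewrite !innerE; lra.
Qed.

Lemma resolvent_nonexpansive x y :
  inner (J x - J y) (J x - J y) <= inner (x - y) (x - y).
Proof.
have := resolvent_firmly_nonexpansive x y.
have := innerxx_ge0 ((x - y) - (J x - J y)).
move: (x - y) (J x - J y) => u v; rewrite !innerE (innerC v u); lra.
Qed.

Lemma resolvent_fixedP x : J x = x <-> B x 0.
Proof.
split=> [Jx|Bx].
  by have := resolventP B lambda x maxB l0; rewrite Jx subrr scaler0.
have := maxB.1 _ _ _ _ (resolventP B lambda x maxB l0) Bx.
rewrite subr0 innerZl pmulr_rge0 ?invr_gt0// -opprB innerNl oppr_ge0 => le0.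
apply/eqP; rewrite -subr_eq0; apply/eqP/innerxx_eq0/le_anti.
by rewrite le0 innerxx_ge0.
Qed.

End resolvent_theory.

Section split_step_theory.
Context {R : realType} {H1 H2 : hilbertType R}.
Context {B1 : H1 -> set H1} {F1 : H2 -> set H2} {A : {linear H1 -> H2}}.
Context {lambda gamma : R}.
Hypotheses (maxB : maximal_monotone B1) (maxF : maximal_monotone F1).
Hypotheses (bA : bounded_near A (nbhs (0 : H1))) (l0 : 0 < lambda).
Local Notation L := (opnorm (adjoint A \o A)).
Local Notation S := (split_step B1 F1 A lambda gamma).
Local Notation T := (fun y => y - resolvent lambda F1 y).

(** Expand [|u - gamma A* d|^2] for [u = x - y], using [<A u, d> >= |d|^2] and
    [|A* d|^2 <= L |d|^2]. The defect term is kept to identify fixed points with solutions. *)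
Lemma split_step_contractive x y : 0 < gamma ->
  inner (S x - S y) (S x - S y) <= inner (x - y) (x - y) -
    gamma * (2 - gamma * L) *
    inner (T (A x) - T (A y)) (T (A x) - T (A y)).
Proof.
move=> g0; apply: le_trans (resolvent_nonexpansive maxB l0 _ _) _.
set d := T (A x) - T (A y).
(* [I - J] inherits firm nonexpansiveness from the resolvent [J]. *)
have dA : inner d d <= inner (A (x - y)) d.
  have := resolvent_firmly_nonexpansive maxF l0 (A x) (A y).
  have -> : d = A (x - y) - (resolvent lambda F1 (A x) - resolvent lambda F1 (A y)).
    by rewrite /d (linearB A) [LHS]subrACA.
  rewrite -(linearB A); move: (A (x - y)) (_ - _) => z e.
  rewrite !innerE (innerC e z); lra.
have -> : x - gamma *: adjoint A (T (A x)) - (y - gamma *: adjoint A (T (A y)))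
    = (x - y) - gamma *: adjoint A d.
  by rewrite [in RHS]adjointB// scalerBr [LHS]subrACA.
have := norm_adjoint_sqr_le A bA d; rewrite -!innerxx => Ld.
move: dA; rewrite adjointP//.
move: (x - y) (adjoint A d) (inner d d) Ld => u w dd Ld dA.
rewrite !innerE (innerC w u).
have h1 := ler_wpM2l (ltW g0) dA.
have g2 : 0 <= gamma ^+ 2 by exact: sqr_ge0.
have h2 := ler_wpM2l g2 Ld.
move: h1 h2; rewrite expr2; lra.
Qed.

Hypotheses (g0 : 0 < gamma) (gL : gamma * L < 2).

Lemma split_step_nonexpansive x y :
  inner (S x - S y) (S x - S y) <= inner (x - y) (x - y).
Proof.
apply: le_trans (split_step_contractive x y g0) _.
by rewrite gerBl mulr_ge0 ?innerxx_ge0// mulr_ge0 ?(ltW g0)// subr_ge0 ltW.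
Qed.

Lemma solution_set_fixed q : solution_set B1 F1 A q -> S q = q.
Proof.
move=> [/(resolvent_fixedP maxB l0) Bq /(resolvent_fixedP maxF l0) Fq].
rewrite /split_step Fq subrr.
have -> : adjoint A 0 = 0 by rewrite -(subrr 0) adjointB// subrr.
by rewrite scaler0 subr0.
Qed.

(** Comparison with a solution [q] forces the defect to vanish, so [A p] is fixed by the resolvent
    of [F1]; the step at [p] then reduces to the resolvent of [B1]. *)
Lemma fixed_solution_set p : solution_set B1 F1 A !=set0 ->
  S p = p -> solution_set B1 F1 A p.
Proof.
move=> [q Gq] Sp; have := split_step_contractive p q g0.
have [_ /(resolvent_fixedP maxF l0) Fq] := Gq.
rewrite Sp (solution_set_fixed _ Gq) Fq subrr subr0.
have gg : 0 < gamma * (2 - gamma * L) by rewrite mulr_gt0// subr_gt0.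
rewrite lerBrDr gerDl pmulr_rle0// => dd.
have Ap0 : A p - resolvent lambda F1 (A p) = 0.
  by apply/innerxx_eq0/le_anti; rewrite dd innerxx_ge0.
have Ap : resolvent lambda F1 (A p) = A p.
  by apply/esym/eqP; rewrite -subr_eq0 Ap0.
split; last exact/(resolvent_fixedP maxF l0).
apply/(resolvent_fixedP maxB l0); rewrite -[RHS]Sp /split_step Ap0.
by rewrite -(subrr 0) adjointB// subrr scaler0 subr0.
Qed.

End split_step_theory.

(** * Nonexpansive mappings and the Haugazeau iteration *)

Section nonexpansive_mappings.
Context {R : realType} {H : hilbertType R} {S : H -> H}.
Hypothesis nS : forall x y, inner (S x - S y) (S x - S y) <= inner (x - y) (x - y).

Lemma nonexpansive_norm x y : `|S x - S y| <= `|x - y|.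
Proof. by rewrite -(@ler_pXn2r _ 2)// ?nnegrE// -!innerxx. Qed.

Lemma nonexpansive_continuous : continuous S.
Proof.
move=> x; apply/cvgrPdist_lt => e e0; near=> y.
apply: le_lt_trans (nonexpansive_norm _ _) _.
by near: y; exact: cvgr_dist_lt.
Unshelve. all: by end_near. Qed.

Lemma nonexpansive_monotone x y :
  0 <= inner ((x - S x) - (y - S y)) (x - y).
Proof.
rewrite subrACA; have := nS x y.
have := innerxx_ge0 ((x - y) - (S x - S y)).
move: (x - y) (S x - S y) => u v; rewrite !innerE (innerC v u); lra.
Qed.

Lemma nonexpansive_regularized_root (x0 : H) (s : R) : 0 < s ->
  exists z, z - S z = s *: (x0 - z).
Proof.
move=> s0; have s1 : 0 < 1 + s by rewrite addr_gt0.
(* The equation says that [z] is fixed by [f], a contraction of ratio [1 / (1 + s)]. *)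
pose f z := (1 + s)^-1 *: (s *: x0 + S z).
pose F : {fun [set: H] >-> [set: H]} :=
  HB.pack f (isFun.Build _ _ setT setT f (fun _ _ => I)).
have q0 : 0 <= (1 + s)^-1 by rewrite invr_ge0 ltW.
have cF : is_contraction F.
  exists (NngNum q0); split => /=; first by rewrite invf_lt1// ltrDl.
  move=> [x y] _ /=; rewrite -scalerBr normrZ ger0_norm//.
  apply: ler_wpM2l => //; rewrite opprD addrACA subrr add0r.
  exact: nonexpansive_norm.
have [|z _ zF] := banach_fixed_point cF closedT; first by exists x0.
exists z; have /esym : (1 + s) *: z = s *: x0 + S z.
  by rewrite {1}zF /= /f scalerA mulfV ?gt_eqF// scale1r.
rewrite scalerDl scale1r scalerBr => h.
by apply/eqP; rewrite subr_eq addrAC eq_sym subr_eq h.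
Qed.

End nonexpansive_mappings.

(** * The regularization path and its limit *)

Section regularization_path.
Context {R : realType} {H : hilbertType R} {S : H -> H}.
Hypothesis nS : forall x y, inner (S x - S y) (S x - S y) <= inner (x - y) (x - y).

(** Monotonicity of [I - S] puts [z] in the ball having the segment from [x0] to [q] as a
    diameter. *)
Lemma regularized_root_bound (x0 z q : H) (s : R) : 0 < s ->
  z - S z = s *: (x0 - z) -> S q = q -> `|z - x0| <= `|q - x0|.
Proof.
move=> s0 zE Sq; have := nonexpansive_monotone nS z q.
rewrite zE Sq subrr subr0 innerZl pmulr_rge0// => h.
rewrite -(@ler_pXn2r _ 2)// ?nnegrE// -!innerxx.
have := innerxx_ge0 ((q - x0) - (z - x0)).
move: h; have [-> ->] : x0 - z = - (z - x0) /\ z - q = (z - x0) - (q - x0).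
  by rewrite opprB opprB addrA subrK.
move: (z - x0) (q - x0) => u v; rewrite !innerE (innerC v u); lra.
Qed.

(** For [u = z - x0] and [v = w - x0], monotonicity gives
    [s (<u, v> - |u|^2) >= t (|v|^2 - <u, v>)]. With [t < s] and [|u - v|^2 >= 0] this yields
    [|u|^2 <= <u, v>], which is the claim. *)
Lemma regularized_root_dist (x0 z w : H) (s t : R) : 0 < t -> t < s ->
  z - S z = s *: (x0 - z) -> w - S w = t *: (x0 - w) ->
  `|z - w| ^+ 2 <= `|w - x0| ^+ 2 - `|z - x0| ^+ 2.
Proof.
move=> t0 ts zE wE; have := nonexpansive_monotone nS z w.
rewrite zE wE -!innerxx.
have [-> ->] : x0 - z = - (z - x0) /\ x0 - w = - (w - x0) by rewrite !opprB.
have -> : z - w = (z - x0) - (w - x0) by rewrite opprB addrA subrK.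
move: (z - x0) (w - x0) => u v; have := innerxx_ge0 (u - v).
rewrite !innerE (innerC v u).
move: (inner u u) (inner v v) (inner u v) => uu vv uv; nra.
Qed.

Lemma regularization_path_cvg (x0 q : H) : S q = q ->
  exists (z : nat -> H) (s : nat -> R) (p : H),
    [/\ forall n, 0 < s n, forall n, z n - S (z n) = s n *: (x0 - z n),
        z @ \oo --> p & S p = p].
Proof.
move=> Sq; pose s n : R := n.+1%:R^-1.
have s0 n : 0 < s n by rewrite invr_gt0.
have /choice[z zE] n := nonexpansive_regularized_root nS x0 (s n) (s0 n).
have dist n k : (n < k)%N ->
    `|z n - z k| ^+ 2 <= `|z k - x0| ^+ 2 - `|z n - x0| ^+ 2.
  move=> nk; apply: regularized_root_dist (zE n) (zE k) => //.
  by rewrite /s ltf_pV2 ?posrE// ltr_nat.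
pose nu n := `|z n - x0| ^+ 2.
have /cvg_ex[l nul] : cvg (nu @ \oo).
  apply: nondecreasing_is_cvgn.
    move=> n k; rewrite leq_eqVlt => /predU1P[->//|/dist nk].
    by rewrite /nu -subr_ge0; apply: le_trans nk; exact: sqr_ge0.
  exists (`|q - x0| ^+ 2) => _ [n _ <-]; rewrite /nu ler_pXn2r ?nnegrE//.
  exact: regularized_root_bound (s0 n) (zE n) Sq.
have e0 : (fun n => `|nu n - l|) @ \oo --> (0 : R).
  have <- : `|l - l| = 0 by rewrite subrr normr0.
  by apply: cvg_norm; apply: cvgB => //; exact: cvg_cst.
have /cvg_ex[p zp] : cvg (z @ \oo).
  apply: sqr_dist_cauchy_cvg e0 _ => n k.
  have tri : `|nu n - nu k| <= `|nu n - l| + `|nu k - l|.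
    by rewrite (distrC (nu k)); exact: (ler_distD l).
  apply: le_trans tri.
  have [nk|kn|->] := ltngtP n k; last first.
    by rewrite !subrr !normr0 expr0n.
    by rewrite (distrC (z n)); apply: le_trans (dist _ _ kn) (ler_norm _).
  by apply: le_trans (dist _ _ nk) _; rewrite (distrC (nu n)) ler_norm.
exists z, s, p; split => //.
have Sz : (S \o z) @ \oo --> S p.
  by apply: continuous_cvg zp; exact: nonexpansive_continuous.
(* The residuals tend to [p - S p], and also to 0 because [s n] does. *)
have zS : (fun n => z n - S (z n)) @ \oo --> p - S p by exact: cvgB.
have : (fun n => z n - S (z n)) @ \oo --> (0 : R) *: (x0 - p).
  under eq_fun do rewrite zE.
  apply: cvgZ; first exact: cvg_harmonic.
  by apply: cvgB => //; exact: cvg_cst.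
rewrite scale0r => /(cvg_unique (@norm_hausdorff _ _) zS)/eqP.
by rewrite subr_eq0 => /eqP/esym.
Qed.

End regularization_path.

(** * Half-spaces and strong convergence of the Haugazeau iteration *)

Section haugazeau.
Context {R : realType} {H : hilbertType R}.

Lemma closed_cut_halfspace (x y : H) : closed (cut_halfspace x y).
Proof.
apply: (@preimage_closed _ _ (fun u => inner (u - y) (x - y)) [set r | r <= 0]).
  move=> u _; apply: (@continuous_comp _ _ _ (fun u => u - y)
    (fun v => inner v (x - y))); last exact: continuous_innerl.
  by apply: cvgB => //; exact: cvg_cst.
exact: closed_le.
Qed.

Lemma convex_cut_halfspace (x y a b : H) (t : R) :
  cut_halfspace x y a -> cut_halfspace x y b -> 0 <= t <= 1 ->
  cut_halfspace x y (a + t *: (b - a)).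
Proof.
rewrite /cut_halfspace /= => ha hb /andP[t0 t1].
have -> : a + t *: (b - a) - y = (1 - t) *: (a - y) + t *: (b - y).
  rewrite scalerBl scale1r -[RHS]addrA [- (t *: _) + _]addrC -scalerBr.
  by rewrite opprB addrA subrK addrAC.
by rewrite innerDl !innerZl; nra.
Qed.

Context {S : H -> H}.
Hypothesis nS : forall x y, inner (S x - S y) (S x - S y) <= inner (x - y) (x - y).

(** If [S y] differs from [y], the half-space is bounded by the perpendicular bisector of [y] and
    [S y], and [q] is at least as close to [S y] as to [y]. *)
Lemma fixed_cut_half_averaged q y : S q = q ->
  cut_halfspace y (half_averaged S y) q.
Proof.
move=> Sq; rewrite /cut_halfspace /half_averaged /=.
have := nS q y; rewrite Sq !innerE !(innerC _ q) (innerC (S y) y); lra.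
Qed.

(** A point beyond the bisector is at least half of [|y - S y|] away from [y]. *)
Lemma cut_half_averaged_dist y u :
  cut_halfspace y (half_averaged S y) u ->
  `|y - S y| ^+ 2 <= 4 * `|u - y| ^+ 2.
Proof.
rewrite /cut_halfspace /half_averaged /= -!innerxx.
have := innerxx_ge0 ((u - y) + 2^-1 *: (y - S y)).
rewrite !innerE (innerC y u) (innerC (S y) u) (innerC (S y) y); lra.
Qed.

Theorem haugazeau_cvg (x0 : H) (x : nat -> H) :
  (exists q, S q = q) -> x 0%N = x0 ->
  (forall k, x k.+1 = metric_proj (cut_halfspace x0 (x k) `&`
     cut_halfspace (x k) (half_averaged S (x k))) x0) ->
  exists2 p, S p = p & x @ \oo --> p.
Proof.
move=> [q Sq] x00 xS.
pose C k := cut_halfspace x0 (x k) `&` cut_halfspace (x k) (half_averaged S (x k)).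
have clC k : closed (C k) by apply: closedI; exact: closed_cut_halfspace.
have cvxC k a b (t : R) : C k a -> C k b -> 0 <= t <= 1 -> C k (a + t *: (b - a)).
  by move=> [a1 a2] [b1 b2] t01; split; exact: convex_cut_halfspace.
(* By induction: fixed points in [C k] make it nonempty, and the variational inequality of the
   projection [x k.+1] is then membership in the next first half-space. *)
have fixC k u : S u = u -> C k u.
  move=> Su; split; last exact: fixed_cut_half_averaged.
  elim: k u Su => [|k IH] u Su; first by rewrite /cut_halfspace /= x00 subrr inner0r.
  have Cu v : S v = v -> C k v.
    by move=> Sv; split; [exact: IH|exact: fixed_cut_half_averaged].
  have [_ ] := metric_projP (C k) x0 (clC k) (ex_intro _ q (Cu q Sq)) (cvxC k).
  by move=> /(_ u (Cu u Su)); rewrite -xS /cut_halfspace /= innerC.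
have xC k : C k (x k.+1).
  rewrite xS; have [] // := metric_projP (C k) x0 (clC k) _ (cvxC k).
  by exists q; exact: fixC.
have bound k u : S u = u -> `|x k - x0| <= `|u - x0|.
  move=> Su; have [+ _] := fixC k u Su; rewrite /cut_halfspace /= => h.
  rewrite -(@ler_pXn2r _ 2)// ?nnegrE// -!innerxx.
  have := innerxx_ge0 (u - x k); move: h.
  rewrite !innerE !(innerC _ u) (innerC x0 (x k)); lra.
pose a k := `|x k - x0| ^+ 2.
(* Since [x k.+1] lies in [cut_halfspace x0 (x k)], the angle at [x k] is not acute; the increments
   of [a] thus control the steps and, through the second half-space, the residuals. *)
have step k : `|x k.+1 - x k| ^+ 2 <= a k.+1 - a k.
  have [+ _] := xC k; rewrite /cut_halfspace /a /= -!innerxx.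
  rewrite !innerE !(innerC _ (x k.+1)) (innerC x0 (x k)); lra.
have /cvg_ex[l al] : cvg (a @ \oo).
  apply: nondecreasing_is_cvgn.
    by apply/nondecreasing_seqP => k; rewrite -subr_ge0 (le_trans _ (step k))// sqr_ge0.
  exists (`|q - x0| ^+ 2) => _ [n _ <-]; rewrite /a ler_pXn2r ?nnegrE//.
  exact: bound.
have g0 : (fun k => `|x k - S (x k)| ^+ 2) @ \oo --> (0 : R).
  apply: (@squeeze_cvgr _ _ _ _ (fun=> 0) (fun k => 4 * (a k.+1 - a k))).
  - apply: nearW => k; rewrite sqr_ge0 /=.
    have [_ /cut_half_averaged_dist] := xC k => /le_trans; apply.
    by rewrite ler_pM2l.
  - exact: cvg_cst.
  - rewrite -(mulr0 4) -(subrr l); apply: cvgMr; apply: cvgB => //.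
    by rewrite cvg_shiftS.
have [z [s [p [s0 zE zp Sp]]]] := regularization_path_cvg nS x0 q Sq.
exists p => //.
(* Adding 1 keeps [r] positive even if [p = x0]. *)
pose r := `|p - x0| + 1.
have r0 : 0 < r by rewrite ltr_wpDl.
have zr n : `|x0 - z n| <= r.
  rewrite distrC; apply: le_trans (regularized_root_bound nS _ _ _ _ (s0 n) (zE n) Sp) _.
  by rewrite lerDl.
have xr k : `|x k - x0| <= r.
  by apply: le_trans (bound k p Sp) _; rewrite lerDl.
have pr : `|x0 - p| <= r by rewrite distrC lerDl.
(* Monotonicity of [I - S] at [z n] and [x k] replaces the demiclosedness
   argument along weak cluster points. *)
have key n k : `|x k - p| ^+ 2 <=
    4 * r * `|x k - S (x k)| / s n + 6 * r * `|z n - p|.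
  have xz : `|x k - z n| <= 2 * r.
    have := ler_distD x0 (x k) (z n); have := xr k; have := zr n; lra.
  have xp : `|x k - p| <= 2 * r.
    have := ler_distD x0 (x k) p; have := xr k; lra.
  have mon : inner (x0 - z n) (x k - z n) <= 2 * r * `|x k - S (x k)| / s n.
    rewrite ler_pdivlMr// mulrC.
    have := nonexpansive_monotone nS (x k) (z n).
    rewrite zE innerDl innerNl innerZl subr_ge0 => /le_trans; apply.
    apply: le_trans (inner_le_norm _ _) _.
    by rewrite mulrC; exact: ler_wpM2r.
  (* [h3] gives [|x k - p|^2 <= 2 <x0 - p, x k - p>]. Replacing [p] by [z n] in the two factors
     costs [h1] and [h2], twice [2 r + r], whence the constant 6. *)
  have h1 : inner (z n - p) (x k - p) <= `|z n - p| * (2 * r).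
    by apply: le_trans (inner_le_norm _ _) _; exact: ler_wpM2l.
  have h2 : inner (z n - p) (x0 - z n) <= `|z n - p| * r.
    by apply: le_trans (inner_le_norm _ _) _; exact: ler_wpM2l.
  have h3 : inner (x k - x0) (x k - x0) <= inner (p - x0) (p - x0).
    by rewrite !innerxx ler_pXn2r ?nnegrE//; exact: bound.
  have -> : 4 * r * `|x k - S (x k)| / s n = 2 * (2 * r * `|x k - S (x k)| / s n).
    by field; rewrite gt_eqF.
  rewrite -innerxx; move: mon h1 h2 h3; move: (2 * r * _ / s n) => m.
  have -> : x0 - z n = - (z n - x0) by rewrite opprB.
  have -> : x k - z n = (x k - x0) - (z n - x0) by rewrite opprB addrA subrK.
  have -> : x k - p = (x k - x0) - (p - x0) by rewrite opprB addrA subrK.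
  have -> : z n - p = (z n - x0) - (p - x0) by rewrite opprB addrA subrK.
  move: (x k - x0) (z n - x0) (p - x0) => u w v.
  by rewrite !innerE (innerC v u) (innerC w u) (innerC v w); lra.
apply/cvgrPdist_lt => e e0.
have e2 : 0 < e ^+ 2 / 2 by rewrite divr_gt0// exprn_gt0.
(* The index [n] is fixed first, so that [s n] is a constant when [k] tends to infinity. *)
have [n zn] : exists n, 6 * r * `|z n - p| < e ^+ 2 / 2.
  have r6 : 0 < 6 * r by rewrite mulr_gt0.
  have /cvgrPdist_lt/(_ (e ^+ 2 / 2 / (6 * r))) := zp.
  rewrite divr_gt0// => /(_ isT)[N _ /(_ N (leqnn N))] /= zN.
  by exists N; rewrite distrC mulrC -ltr_pdivlMr.
have r4 : 0 < 4 * r / s n by rewrite divr_gt0// mulr_gt0.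
have d0 : 0 < e ^+ 2 / 2 / (4 * r / s n) by rewrite divr_gt0.
near=> k; rewrite distrC -(@ltr_pXn2r _ 2)// ?nnegrE ?(ltW e0)//.
apply: le_lt_trans (key n k) _; rewrite (splitr (e ^+ 2)) ltrD//.
rewrite mulrAC mulrC -ltr_pdivlMr// -(@ltr_pXn2r _ 2)// ?nnegrE ?(ltW d0)//.
rewrite -[ltLHS]ger0_norm ?sqr_ge0//; near: k.
by move/cvgr0Pnorm_lt: g0; apply; rewrite exprn_gt0.
Unshelve. all: by end_near. Qed.

End haugazeau.

(** * Application to the split inclusion problem *)

(** The condition [gamma < 2 / L] is written as a product so that [L = 0] imposes no upper bound. *)
Theorem mainTheorem5 (R : realType) (H1 H2 : hilbertType R)
  (B1 : H1 -> set H1) (F1 : H2 -> set H2) (A : {linear H1 -> H2})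
  (lambda gamma : R) (x0 : H1) (x : nat -> H1) :
  maximal_monotone B1 -> maximal_monotone F1 ->
  bounded_near A (nbhs (0 : H1)) ->
  0 < lambda ->
  solution_set B1 F1 A !=set0 ->
  0 < gamma -> gamma * opnorm (adjoint A \o A) < 2 ->
  let S := split_step B1 F1 A lambda gamma in
  x 0%N = x0 ->
  (forall k, x k.+1 =
     metric_proj (cut_halfspace x0 (x k) `&` cut_halfspace (x k) (half_averaged S (x k))) x0) ->
  exists2 xstar : H1, solution_set B1 F1 A xstar & x @ \oo --> xstar.
Proof.
move=> maxB maxF bA l0 G0 g0 gL S x00 xS.
have fixS q : solution_set B1 F1 A q -> S q = q by exact: solution_set_fixed.
have nS := split_step_nonexpansive maxB maxF bA l0 g0 gL.
have [|p Sp xp] := haugazeau_cvg nS x0 x _ x00 xS.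
  by case: G0 => q /fixS; exists q.
by exists p => //; apply: fixed_solution_set Sp.
Qed.
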